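(* There is an absolute constant $c>0$ such that for all sufficiently large $n$ there is a probability distribution over instances (sequences of $2n$ insertions, exactly $n$ of which increment $p$ and $n$ of which increment $q$, starting from $p=q=0$) such that for every family of bijections $(f_{p,q})$, the expected total cost over a random instance from this distribution is at least $c\, n\log n/\log\log n$; i.e., the expected amortized cost per insertion is $\Omega(\log n/\log\log n)$.
   Context: Balls-to-bins problem: the state is $(p,q)$; there are balls $a_1,\dots,a_p,b_1,\dots,b_q$ and bins $1,\dots,p+q$, and the placement is a bijection $f_{p,q}$ from balls to bins depending only on $(p,q)$. An insertion increments $p$ (creating ball $a_{p+1}$) or $q$ (creating ball $b_{q+1}$) together with a new bin, and the placement switches to the new bijection. The cost of an insertion is the number of balls whose bin changes (relocated balls). This is the special case of the two-way adapter problem where only allocations occur. *)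

(* Defs.v *)
From Stdlib Require Import Reals.
From mathcomp Require Import all_boot all_order all_algebra.
From mathcomp Require Import Rstruct.
Set Implicit Arguments. Unset Strict Implicit. Unset Printing Implicit Defensive.
Import GRing.Theory Num.Theory.

(* Balls at state (p,q): inl i = a_(i+1), inr j = b_(j+1).
   Bins at state (p,q): 'I_(p+q), bin k+1 represented by k. *)
Definition balls (p q : nat) := ('I_p + 'I_q)%type.

Definition placement := forall p q : nat, balls p q -> 'I_(p + q).

Definition bij_family (f : placement) : Prop := forall p q, bijective (f p q).

Definition lift_a p q (x : balls p q) : balls p.+1 q :=
  match x with inl i => inl (widen_ord (leqnSn p) i) | inr j => inr j end.
Definition lift_b p q (x : balls p q) : balls p q.+1 :=
  match x with inl i => inl i | inr j => inr (widen_ord (leqnSn q) j) end.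

Definition step_cost (f : placement) (p q : nat) (b : bool) : nat :=
  if b then #|[pred x : balls p q | nat_of_ord (f p.+1 q (lift_a x)) != nat_of_ord (f p q x)]|
  else #|[pred x : balls p q | nat_of_ord (f p q.+1 (lift_b x)) != nat_of_ord (f p q x)]|.

Fixpoint cost_from (f : placement) (p q : nat) (s : seq bool) : nat :=
  match s with
  | [::] => 0
  | b :: s' => step_cost f p q b +
               (if b then cost_from f p.+1 q s' else cost_from f p q.+1 s')
  end.

Definition instance_distr (n : nat) (mu : {ffun (n.*2).-tuple bool -> R}) : Prop :=
  [/\ (forall t, (0 <= mu t)%R),
      (\sum_t mu t = 1)%R
    & (forall t, mu t != 0%R -> count id t = n)].

Definition expected_cost (n : nat) (mu : {ffun (n.*2).-tuple bool -> R})
  (f : placement) : R :=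
  (\sum_t mu t * (cost_from f 0 0 t)%:R)%R.

(* Main.v *)
(* A path is a sequence of blocks whose displacements are fixed.  Two facts drive
   the recursion.  First, a layout restarted at a state (p, q) induces, by
   following old balls through the bins they held at (p, q), a layout of the
   later balls into the later bins; the cost from (p, q) on is at least the cost
   of the induced layout plus the number of old balls that end up away from
   their bin of (p, q).  Second, if few balls are displaced across block
   boundaries, then a ball sits in the group of bins created in the block where
   the ball was born, so the final state determines the path up to block
   resolution.

   A level-(j+1) path consists of 4J copies of a level-j path, each followed by
   d_j = m_j / J extra insertions of one kind, a's in one half of the copies and
   b's in the other half.  The two orders of the halves end in the same state,
   but a constant fraction of the a's are born in different blocks, so
   Omega(m_(j+1)) balls are displaced in addition to the costs inside the
   blocks.  The lengths grow by a factor 4J + 2 rather than 4J, which over J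
   levels loses only a constant, so J levels give amortized cost Omega(J) with
   J of order log n / log log n. *)
Require Import Defs.
From Stdlib Require Import Reals.
From mathcomp Require Import all_boot all_order all_algebra.
From mathcomp Require Import Rstruct.
From mathcomp Require Import zify.
From Stdlib Require Import Lra Lia.
Set Implicit Arguments. Unset Strict Implicit. Unset Printing Implicit Defensive.
Import GRing.Theory Num.Theory.

Local Open Scope nat_scope.

(** * Chains of an injection on an initial segment, followed until they leave it *)

Definition through (N : nat) (g : nat -> nat) (z : nat) := if z < N then g z else z.

Section Chains.
Variables (N : nat) (g : nat -> nat).
Hypothesis g_inj : forall x y, x < N -> y < N -> g x = g y -> x = y.

Local Notation G := (through N g).

Lemma through_lt z : z < N -> G z = g z.
Proof. by rewrite /through => ->. Qed.

Lemma iter_through_stop i z : N <= z -> iter i G z = z.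
Proof. by move=> zN; elim: i => //= i ->; rewrite /through ltnNge zN. Qed.

Lemma iter_through_lt i j z : i <= j -> iter j G z < N -> iter i G z < N.
Proof.
move=> /subnK <-; rewrite iterD; case: (ltnP (iter i G z) N) => // h.
by rewrite iter_through_stop // ltnNge h.
Qed.

(** Injectivity allows cancelling [g] on both sides; if one chain ran out first, its starting point
    would be a value of [g]. *)
Lemma chain_inj i j z1 z2 :
    (forall x, x < N -> g x != z1) -> (forall x, x < N -> g x != z2) ->
    (forall i', i' < i -> iter i' G z1 < N) ->
    (forall j', j' < j -> iter j' G z2 < N) ->
    iter i G z1 = iter j G z2 -> i = j /\ z1 = z2.
Proof.
move=> h1 h2; elim: i j => [|i IH] [|j] //= lti ltj.
- rewrite (through_lt (ltj j _)) // => e.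
  by have := h1 _ (ltj j (ltnSn j)); rewrite -e eqxx.
- rewrite (through_lt (lti i _)) // => e.
  by have := h2 _ (lti i (ltnSn i)); rewrite e eqxx.
- rewrite (through_lt (lti i _)) // (through_lt (ltj j _)) // => /g_inj e.
  have [||e' ->] := IH j _ _ (e (lti i (ltnSn i)) (ltj j (ltnSn j))).
  + by move=> i' hi; apply: lti; rewrite ltnW.
  + by move=> j' hj; apply: ltj; rewrite ltnW.
  + by rewrite e'.
Qed.

(** Pigeonhole: otherwise the first [N + 1] iterates would be distinct points below [N]. *)
Lemma iter_through_exit z : (forall x, x < N -> g x != z) -> N <= iter N G z.
Proof.
move=> hz; rewrite leqNgt; apply/negP => ltN.
have lt i : i <= N -> iter i G z < N by move=> iN; apply: iter_through_lt iN ltN.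
pose F (i : 'I_N.+1) : 'I_N := Ordinal (lt i (ltn_ord i)).
have F_inj : injective F.
  move=> i j /(congr1 val); rewrite /= => e; apply: val_inj => /=.
  have ltN' (k : 'I_N.+1) i' : i' < k -> iter i' G z < N.
    by move=> ik; apply: (lt i'); have := ltn_ord k; lia.
  by have [] := chain_inj hz hz (ltN' i) (ltN' j) e.
by have := leq_card F F_inj; rewrite !card_ord ltnn.
Qed.

Lemma exit_index z : (forall x, x < N -> g x != z) ->
  exists2 i, forall i', i' < i -> iter i' G z < N & iter N G z = iter i G z.
Proof.
move=> /iter_through_exit; elim: {2 6}N => [|k IH] // h; first by exists 0.
case: (ltnP (iter k G z) N) => hk.
  by exists k.+1 => // i' ik; apply: iter_through_lt hk.
have [i lti e] := IH hk; exists i => //.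
by rewrite iterS e [LHS]/through -e ltnNge hk.
Qed.

Lemma exit_inj z1 z2 :
    (forall x, x < N -> g x != z1) -> (forall x, x < N -> g x != z2) ->
  iter N G z1 = iter N G z2 -> z1 = z2.
Proof.
move=> h1 h2; have [i lti ->] := exit_index h1; have [j ltj ->] := exit_index h2.
by case/(chain_inj h1 h2 lti ltj).
Qed.

(** Cancelling [g] moves a fixed point back along the chain to [z], which is not a value of [g]. *)
Lemma chain_not_fixed i z : (forall x, x < N -> g x != z) ->
  iter i G z < N -> g (iter i G z) != iter i G z.
Proof.
move=> hz; elim: i => [|i IH] lt; first exact: hz.
have lti : iter i G z < N by apply: iter_through_lt lt.
apply/eqP => e; have := IH lti; rewrite /= (through_lt lti) in lt e.
by rewrite (g_inj lt lti e) eqxx.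
Qed.

Lemma chain_first_change g' z :
  iter N G z != iter N (through N g') z ->
  exists i, (iter i G z < N) && (g (iter i G z) != g' (iter i G z)).
Proof.
move=> neq; pose P i := (iter i G z < N) && (g (iter i G z) != g' (iter i G z)).
have [/hasP [i _ Pi]|/hasPn no] := boolP (has P (iota 0 N)); first by exists i.
case/eqP: neq; have := leqnn N; elim: {1 3 5}N => [|k IH] // kN /=.
rewrite -(IH (ltnW kN)) /through.
case: ifP => // lt; have := no k; rewrite mem_iota kN /P lt /= => /(_ isT).
by rewrite negbK => /eqP.
Qed.

Section Step.
Variables (Y : eqType) (s : seq Y) (n n' : Y -> nat) (g' : nat -> nat).
Hypothesis s_uniq : uniq s.
Hypothesis n_inj : {in s &, injective n}.
Hypothesis n_new : {in s, forall y x, x < N -> g x != n y}.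

(* A ball whose chain changes is charged to some relocated ball on its old
   chain.  Chains are disjoint and contain no fixed point of [g], so a fixed
   point that ceases to be one pays separately. *)
Lemma count_chain_changes :
  count (fun y => iter N G (n y) != iter N (through N g') (n' y)) s
    + count (fun x => g' x != x) (iota 0 N)
  <= count (fun y => n y != n' y) s + count (fun x => g x != g' x) (iota 0 N)
    + count (fun x => g x != x) (iota 0 N).
Proof.
set F := fun y => _ != _.
pose C y := F y && (n y == n' y).
have exi y : C y -> exists i,
    (iter i G (n y) < N) && (g (iter i G (n y)) != g' (iter i G (n y))).
  by case/andP=> Fy /eqP e; apply: chain_first_change; rewrite {2}e.
(* The default 0 is taken only outside [C], where [phi] is never evaluated. *)
pose idx y := if boolP (C y) is AltTrue h then ex_minn (exi y h) else 0.
pose phi y := iter (idx y) G (n y).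
have phiP y : C y -> phi y < N /\ g (phi y) != g' (phi y).
  move=> Cy; rewrite /phi /idx; case: {-}_ / boolP => [h|/negP //].
  by case: ex_minnP => i /andP.
(* Disjointness of the chains makes [phi] injective on [C], and points on a chain are not fixed by
   [g]. *)
have le1 : count C s <= count (fun x => (g x != g' x) && (g x != x)) (iota 0 N).
  rewrite -!size_filter -(size_map phi); apply: uniq_leq_size.
    rewrite map_inj_in_uniq ?filter_uniq // => y1 y2.
    rewrite !mem_filter => /andP [C1 s1] /andP [C2 s2] e; apply: n_inj => //.
    have lt u : C u -> forall i', i' < idx u -> iter i' G (n u) < N.
      by move=> /phiP [h _] i' /ltnW hi; apply: iter_through_lt hi h.
    by case: (chain_inj (n_new s1) (n_new s2) (lt _ C1) (lt _ C2) e).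
  move=> x /mapP [y]; rewrite mem_filter => /andP [Cy sy] ->.
  have [lt ne] := phiP y Cy.
  rewrite mem_filter ne mem_iota lt /= andbT.
  by apply: chain_not_fixed => //; exact: n_new.
have le2 : count F s <= count C s + count (fun y => n y != n' y) s.
  elim: (s) => //= y t IH; rewrite [C y]/C.
  by move: IH; case: (F y); case: (n y == n' y) => /=; lia.
have split_by (a b : pred nat) t :
    count a t = count (fun x => a x && b x) t + count (fun x => a x && ~~ b x) t.
  by elim: t => //= x t ->; case: (a x); case: (b x) => /=; lia.
have le3 : count (fun x => g' x != x) (iota 0 N)
    <= count (fun x => g x != x) (iota 0 N)
       + count (fun x => (g x != g' x) && ~~ (g x != x)) (iota 0 N).
  elim: (iota 0 N) => //= x t IH; case: (g x =P x) => [->|_] /=; last by case: eqP; lia.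
  by rewrite andbT eq_sym; case: eqP => /=; lia.
rewrite (split_by (fun x => g x != g' x) (fun x => g x != x)); lia.
Qed.
End Step.
End Chains.

(** * Layouts with ball names that do not depend on the state *)

Definition ball := (nat + nat)%type.
Definition layout := nat -> nat -> ball -> nat.

Definition present (p q : nat) (x : ball) :=
  match x with inl i => i < p | inr j => j < q end.

Definition ball_seq (p q : nat) : seq ball := map inl (iota 0 p) ++ map inr (iota 0 q).

(** As there are [p + q] present balls, the two conditions make [g p q] a bijection from them onto
    the bins; values at absent balls are arbitrary. *)
Definition good (g : layout) := forall p q,
  {in ball_seq p q &, injective (g p q)} /\
  {in ball_seq p q, forall x, g p q x < p + q}.

Definition moved (g : layout) p q p' q' :=
  count (fun x => g p' q' x != g p q x) (ball_seq p q).

Fixpoint lcost (g : layout) (p q : nat) (s : seq bool) : nat :=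
  if s is b :: s' then
    if b then moved g p q p.+1 q + lcost g p.+1 q s'
    else moved g p q p q.+1 + lcost g p q.+1 s'
  else 0.

Lemma mem_ball_seq p q x : (x \in ball_seq p q) = present p q x.
Proof.
rewrite mem_cat; case: x => i; rewrite /= ?(mem_map inl_inj) ?(mem_map inr_inj) mem_iota add0n.
  by rewrite [X in _ || X](introF mapP) ?orbF // => -[].
by rewrite [X in X || _](introF mapP) // => -[].
Qed.

Lemma ball_seq_uniq p q : uniq (ball_seq p q).
Proof.
rewrite cat_uniq !map_inj_uniq ?iota_uniq ?andbT //=; try exact: inl_inj; try exact: inr_inj.
by apply/hasPn => x /mapP [i _ ->]; apply/mapP => -[].
Qed.

Lemma size_ball_seq p q : size (ball_seq p q) = p + q.
Proof. by rewrite size_cat !size_map !size_iota. Qed.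

Lemma present_mono p q p' q' x : p <= p' -> q <= q' -> present p q x -> present p' q' x.
Proof. by case: x => i /= *; lia. Qed.

Lemma perm_bins g p q : good g -> perm_eq (map (g p q) (ball_seq p q)) (iota 0 (p + q)).
Proof.
move=> /(_ p q) [inj lt]; have u : uniq (map (g p q) (ball_seq p q)).
  by rewrite map_inj_in_uniq ?ball_seq_uniq.
apply: uniq_perm; rewrite ?iota_uniq //.
apply: (uniq_min_size u _ _).2; last by rewrite size_map size_ball_seq size_iota.
by move=> z /mapP [x /lt h ->]; rewrite mem_iota.
Qed.

Lemma lcost_cat g p q u v : lcost g p q (u ++ v) =
  lcost g p q u + lcost g (p + count id u) (q + count negb u) v.
Proof.
elim: u p q => [|b u IH] p q /=; first by rewrite !addn0.
by case: b => /=; rewrite IH addnA ?add0n addnA ?add1n ?addn1 ?addSnnS.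
Qed.

(** * The layout induced on the balls born after a given state *)

Definition occupant (g : layout) p q z : ball :=
  nth (inl 0) (ball_seq p q) (index z (map (g p q) (ball_seq p q))).

Definition shift p q (y : ball) : ball :=
  match y with inl i => inl (p + i) | inr j => inr (q + j) end.

(* First-return map: the balls present at [(p, q)] are identified with the bins
   they occupy there and are skipped, which leaves a layout of the later balls
   into the later bins. *)
Definition rebase (g : layout) p q : layout := fun k l y =>
  iter (p + q) (through (p + q) (fun z => g (p + k) (q + l) (occupant g p q z)))
    (g (p + k) (q + l) (shift p q y)) - (p + q).

Section Rebase.
Variable g : layout.
Hypothesis g_good : good g.
Variables p q : nat.
Local Notation N := (p + q).
Local Notation occ := (occupant g p q).

Lemma occupantP z : z < N -> occ z \in ball_seq p q /\ g p q (occ z) = z.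
Proof.
move=> zN; have zin : z \in map (g p q) (ball_seq p q).
  by rewrite (perm_mem (perm_bins p q g_good)) mem_iota.
have lt : index z (map (g p q) (ball_seq p q)) < size (ball_seq p q).
  by rewrite -index_mem size_map in zin.
by rewrite mem_nth // -(nth_map _ 0) // nth_index.
Qed.

Lemma perm_occupants : perm_eq (map occ (iota 0 N)) (ball_seq p q).
Proof.
have inj : {in iota 0 N &, injective occ}.
  move=> x y; rewrite !mem_iota /= !add0n => /occupantP [_ ex] /occupantP [_ ey] e.
  by rewrite -ex -ey e.
have u : uniq (map occ (iota 0 N)) by rewrite map_inj_in_uniq ?iota_uniq.
apply: uniq_perm; rewrite ?ball_seq_uniq //.
apply: (uniq_min_size u _ _).2; last by rewrite size_map size_ball_seq size_iota.
by move=> z /mapP [x]; rewrite mem_iota /= add0n => /occupantP [h _] ->.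
Qed.

Lemma perm_ball_seqD k l :
  perm_eq (ball_seq (p + k) (q + l)) (ball_seq p q ++ map (shift p q) (ball_seq k l)).
Proof.
have sh_inj : injective (shift p q) by move=> [i|i] [j|j] //= [] /addnI ->.
apply: uniq_perm; first exact: ball_seq_uniq.
  rewrite cat_uniq (map_inj_uniq sh_inj) !ball_seq_uniq andbT /=.
  apply/hasPn => x /mapP [y _ ->]; rewrite /= mem_ball_seq.
  by case: y => i /=; lia.
move=> x; rewrite mem_ball_seq mem_cat mem_ball_seq; apply/idP/orP.
  case: (boolP (present p q x)) => [|np px]; [by left | right; apply/mapP].
  by case: x np px => i /= *; [exists (inl (i - p)) | exists (inr (i - q))];
    rewrite ?mem_ball_seq /= ?subnKC //; lia.
case=> [|/mapP [y]]; first by apply: present_mono; rewrite leq_addr.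
by rewrite mem_ball_seq => py ->; case: y py => i /=; lia.
Qed.

Lemma count_ball_seqD (P : pred ball) k l : count P (ball_seq (p + k) (q + l)) =
  count (fun y => P (shift p q y)) (ball_seq k l) + count (fun z => P (occ z)) (iota 0 N).
Proof.
rewrite (permP (perm_ball_seqD k l)) count_cat addnC count_map.
by rewrite -(permP perm_occupants) count_map.
Qed.

Section At.
Variables k l : nat.
Local Notation new y := (g (p + k) (q + l) (shift p q y)).
Local Notation old := (fun z => g (p + k) (q + l) (occ z)).

Lemma occupant_later z : z < N -> occ z \in ball_seq (p + k) (q + l).
Proof.
by move=> /occupantP [h _]; rewrite (perm_mem (perm_ball_seqD k l)) mem_cat h.
Qed.

Lemma shift_later y : y \in ball_seq k l -> shift p q y \in ball_seq (p + k) (q + l).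
Proof.
by move=> h; rewrite (perm_mem (perm_ball_seqD k l)) mem_cat map_f ?orbT.
Qed.

Lemma old_inj x y : x < N -> y < N -> old x = old y -> x = y.
Proof.
move=> xN yN e; have [inj _] := g_good (p + k) (q + l).
have := inj _ _ (occupant_later xN) (occupant_later yN) e.
by have [_ {2}<-] := occupantP xN; have [_ {2}<-] := occupantP yN => ->.
Qed.

Lemma new_inj : {in ball_seq k l &, injective (fun y => new y)}.
Proof.
move=> x y hx hy e; have [inj _] := g_good (p + k) (q + l).
have := inj _ _ (shift_later hx) (shift_later hy) e.
by case: x y {hx hy e} => i [] j //= [] /addnI ->.
Qed.

Lemma new_old : {in ball_seq k l, forall y z, z < N -> old z != new y}.
Proof.
move=> y hy z zN; apply/eqP => e; have [inj _] := g_good (p + k) (q + l).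
have {}e := inj _ _ (occupant_later zN) (shift_later hy) e.
by have [] := occupantP zN; rewrite e mem_ball_seq; case: (y) => i /=; lia.
Qed.

Lemma iter_old_bound i z : z < N + (k + l) -> iter i (through N old) z < N + (k + l).
Proof.
move=> zN; elim: i => //= i IH; rewrite {1}/through; case: ifP => // lt.
have [_ /(_ _ (occupant_later lt))] := g_good (p + k) (q + l); lia.
Qed.

End At.

Lemma rebase_good : good (rebase g p q).
Proof.
move=> k l; split=> [x y hx hy|y hy]; rewrite /rebase.
  have ex := @iter_through_exit _ _ (@old_inj k l) _ (new_old hx).
  have ey := @iter_through_exit _ _ (@old_inj k l) _ (new_old hy) => e.
  apply: (new_inj hx hy).
  apply: (exit_inj (@old_inj k l) (new_old hx) (new_old hy)).
  by rewrite -(subnK ex) -(subnK ey) e.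
have ey := @iter_through_exit _ _ (@old_inj k l) _ (new_old hy).
rewrite ltn_subLR // iter_old_bound //.
have [_ /(_ _ (shift_later hy))] := g_good (p + k) (q + l); lia.
Qed.

(** The number of old balls away from their bin of [(p, q)] acts as a potential. Relocations in [g]
    split into later and old balls, and by [count_chain_changes] they pay for the induced
    relocations and for the growth of the potential. *)
Lemma moved_rebase k l k' l' :
  moved (rebase g p q) k l k' l' + moved g p q (p + k') (q + l')
  <= moved g (p + k) (q + l) (p + k') (q + l') + moved g p q (p + k) (q + l).
Proof.
rewrite {3}/moved count_ball_seqD.
have movedE a b : moved g p q a b = count (fun z => g a b (occ z) != z) (iota 0 N).
  rewrite /moved -(permP perm_occupants) count_map; apply: eq_in_count => z.
  by rewrite mem_iota /= add0n => /occupantP [_ ->].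
have H := count_chain_changes (@old_inj k l) (fun y => g (p + k') (q + l') (shift p q y))
  (fun z => g (p + k') (q + l') (occ z)) (ball_seq_uniq k l) (@new_inj k l)
  (@new_old k l).
rewrite !movedE; apply: leq_trans (leq_trans H _); last first.
  by rewrite leq_add2r; apply: leq_add; apply/eq_leq/eq_count => x; rewrite eq_sym.
rewrite leq_add2r; apply: sub_count => y; rewrite /rebase.
by apply: contraNN => /eqP ->.
Qed.
End Rebase.

Lemma lcost_rebase g p q w : good g ->
  lcost (rebase g p q) 0 0 w + moved g p q (p + count id w) (q + count negb w)
  <= lcost g p q w.
Proof.
move=> g_good.
(* Generalized to any later state so that [moved_rebase] telescopes; at [(p, q)] itself the
   potential is 0. *)
suff H k l : lcost (rebase g p q) k l w
    + moved g p q (p + (k + count id w)) (q + (l + count negb w))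
  <= lcost g (p + k) (q + l) w + moved g p q (p + k) (q + l).
  have := H 0 0; rewrite !addn0 !add0n => /leq_trans; apply.
  by rewrite /moved (eq_count (a2 := pred0)) ?count_pred0 ?addn0 // => x; rewrite eqxx.
elim: w k l => [|b w IH] k l /=; first by rewrite !addn0.
case: b => /=.
  have := IH k.+1 l; have := moved_rebase g_good p q k l k.+1 l.
  by rewrite (addnS p k) add0n add1n -addSnnS; lia.
have := IH k l.+1; have := moved_rebase g_good p q k l k l.+1.
by rewrite (addnS q l) add0n add1n -addSnnS; lia.
Qed.

Lemma count_ltn_iota k n : count (fun z => z < k) (iota 0 n) = minn k n.
Proof.
elim: n => [|n IH]; first by rewrite minn0.
by rewrite -addn1 iotaD count_cat IH /= add0n; case: ltnP; lia.
Qed.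

(** * Birth blocks and misplaced balls *)

Section Births.
Variables (g : layout) (P Q : nat -> nat) (M r : nat).
Hypothesis g_good : good g.
Hypothesis P_mono : forall i, P i <= P i.+1.
Hypothesis Q_mono : forall i, Q i <= Q i.+1.
Hypothesis PQ : forall i, P i + Q i = i * M.

(** The value is [r] for a ball that none of the [r] blocks creates. *)
Definition birth (x : ball) := find (fun i => present (P i.+1) (Q i.+1) x) (iota 0 r).

Let present_le i j x : i <= j -> present (P i) (Q i) x -> present (P j) (Q j) x.
Proof.
have mono F : (forall k, F k <= F k.+1) -> i <= j -> F i <= F j.
  by move=> F_mono; apply: (homo_leq (r := leq)) => // ? ? ?; apply: leq_trans.
by move=> ij; apply: present_mono; apply: mono.
Qed.

Lemma birthP x : present (P r) (Q r) x ->
  present (P (birth x).+1) (Q (birth x).+1) x && ~~ present (P (birth x)) (Q (birth x)) x.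
Proof.
move=> px; have r_gt0 : 0 < r.
  by move: px (PQ 0); case: (r) => //; case: x => i /=; lia.
have h : has (fun i => present (P i.+1) (Q i.+1) x) (iota 0 r).
  by apply/hasP; exists r.-1; rewrite ?prednK // mem_iota /=; lia.
have br : birth x < r by have := h; rewrite has_find size_iota.
have := nth_find 0 h; rewrite nth_iota // add0n => -> /=.
case e : (birth x) => [|b]; first by have := PQ 0; case: (x) => i /=; lia.
have /(before_find 0) : b < birth x by rewrite e.
by rewrite nth_iota ?add0n => [->|] //; lia.
Qed.

Lemma birth_eq i x : i < r -> present (P i.+1) (Q i.+1) x -> ~~ present (P i) (Q i) x ->
  birth x = i.
Proof.
move=> ir p1 p0.
have /birthP /andP [b1 b0] : present (P r) (Q r) x by apply: present_le p1.
case: (ltngtP (birth x) i) => // lt.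
  by rewrite (present_le lt b1) in p0.
by rewrite (present_le lt p1) in b0.
Qed.

(* Old and new bins are balanced: each ball of the current block placed in an
   earlier bin forces an older ball, which had to move, into the new bins. *)
Lemma misplaced_le i : i <= r ->
  count (fun x => g (P i) (Q i) x %/ M != birth x) (ball_seq (P i) (Q i))
  <= 2 * \sum_(k < i) moved g (P k) (Q k) (P k.+1) (Q k.+1).
Proof.
elim: i => [|i IH] ir.
  rewrite (@leq_trans (size (ball_seq (P 0) (Q 0)))) ?count_size //.
  by rewrite size_ball_seq PQ.
have M_PQ : P i.+1 + Q i.+1 = i * M + M by rewrite PQ mulSn addnC.
rewrite big_ord_recr /= mulnDr.
set p := P i; set q := Q i; set p' := P i.+1; set q' := Q i.+1.
pose new := map (shift p q) (ball_seq (p' - p) (q' - q)).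
have perm : perm_eq (ball_seq p' q') (ball_seq p q ++ new).
  by have := perm_ball_seqD p q (p' - p) (q' - q); rewrite !subnKC ?P_mono ?Q_mono.
rewrite (permP perm) count_cat.
have [_ lt_g] := g_good p q; have [_ lt_g'] := g_good p' q'.
have old_bad : count (fun x => g p' q' x %/ M != birth x) (ball_seq p q)
    <= count (fun x => g p q x %/ M != birth x) (ball_seq p q) + moved g p q p' q'.
  rewrite /moved; elim: (ball_seq p q) => //= x t IHt.
  move: IHt; case: (g p' q' x =P g p q x) => [->|_] IHt /=; first by rewrite add0n -addnA leq_add2l.
  by move: IHt; case: (_ != birth x); case: (_ != birth x) => /=; lia.
(* New balls are born in block [i] and all bins lie below [i.+1 * M], so a misplaced new ball lies
   below [i * M]. *)
have new_bad : count (fun x => g p' q' x %/ M != birth x) new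
    <= count (fun x => g p' q' x < i * M) new.
  rewrite -!size_filter; apply: uniq_leq_size.
    apply: filter_uniq; apply: subseq_uniq (suffix_subseq (ball_seq p q) new) _.
    by rewrite -(perm_uniq perm) ball_seq_uniq.
  move=> x; rewrite !mem_filter => /andP [bad xn]; rewrite xn andbT.
  have x' : x \in ball_seq p' q' by rewrite (perm_mem perm) mem_cat xn orbT.
  have bi : birth x = i.
    apply: birth_eq => //; first by rewrite -mem_ball_seq.
    case/mapP: xn => y _ ->; rewrite -/p -/q; case: (y) => j /=; lia.
  have M_gt0 : 0 < M by have := lt_g' _ x'; move: M_PQ; case: (M) => //; lia.
  move: bad; rewrite bi -ltn_divLR // ltn_neqAle => ->.
  by rewrite -ltnS ltn_divLR //; have := lt_g' _ x'; lia.
have old_far : count (fun x => ~~ (g p' q' x < i * M)) (ball_seq p q) <= moved g p q p' q'.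
  rewrite /moved -!size_filter; apply: uniq_leq_size; first exact/filter_uniq/ball_seq_uniq.
  move=> x; rewrite !mem_filter => /andP [far xo]; rewrite xo andbT.
  by apply: contraNneq far => ->; rewrite -PQ lt_g.
(* The first [i * M] bins are full before and after the block, so new balls entering them are
   matched by old balls leaving them. *)
have balance : count (fun x => g p' q' x < i * M) (ball_seq p q)
    + count (fun x => g p' q' x < i * M) new = i * M.
  rewrite -count_cat -(permP perm) -(count_map (g p' q') (fun z => z < i * M)).
  by rewrite (permP (perm_bins p' q' g_good)) count_ltn_iota M_PQ; lia.
have old_split : count (fun x => g p' q' x < i * M) (ball_seq p q)
    + count (fun x => ~~ (g p' q' x < i * M)) (ball_seq p q) = i * M.
  by have := count_predC (fun x => g p' q' x < i * M) (ball_seq p q); rewrite size_ball_seq PQ.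
have IHi := IH (ltnW ir).
apply: leq_trans (leq_add old_bad new_bad) _.
(* Relocations are charged twice, once for old balls that become misplaced and once for old balls
   that make room for new ones; hence the factor 2. *)
have arith a b c h s u : a <= 2 * s -> c <= h -> b + u = i * M -> b + c = i * M ->
  a + h + u <= 2 * s + 2 * h by lia.
exact: arith IHi old_far balance old_split.
Qed.

End Births.

(** The two paths share the final state and thus the final bins, so a ball with two different birth
    blocks is misplaced for at least one path. *)
Lemma sum_moved_ge (g : layout) (P1 Q1 P2 Q2 : nat -> nat) (M r : nat) : good g ->
  (forall i, P1 i <= P1 i.+1) -> (forall i, Q1 i <= Q1 i.+1) ->
  (forall i, P2 i <= P2 i.+1) -> (forall i, Q2 i <= Q2 i.+1) ->
  (forall i, P1 i + Q1 i = i * M) -> (forall i, P2 i + Q2 i = i * M) ->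
  P1 r = P2 r -> Q1 r = Q2 r ->
  count (fun x => birth P1 Q1 r x != birth P2 Q2 r x) (ball_seq (P1 r) (Q1 r))
  <= 2 * (\sum_(k < r) moved g (P1 k) (Q1 k) (P1 k.+1) (Q1 k.+1)
          + \sum_(k < r) moved g (P2 k) (Q2 k) (P2 k.+1) (Q2 k.+1)).
Proof.
move=> g_good P1m Q1m P2m Q2m PQ1 PQ2 eP eQ; rewrite mulnDr.
apply: leq_trans (leq_add (misplaced_le g_good P1m Q1m PQ1 (leqnn r))
  (misplaced_le g_good P2m Q2m PQ2 (leqnn r))).
rewrite -eP -eQ; elim: (ball_seq _ _) => //= x t.
case: (birth P1 Q1 r x =P _) => [_|] /=; first lia.
by move=> ne; case: eqP => [->|] /=; [case: eqP => //= | ]; lia.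
Qed.

(** * Paths made of copies of one word, separated by runs of extra insertions *)

Section Blocks.
Variables (m d : nat) (beta : nat -> bool).

Definition block_path (r : nat) (w : seq bool) :=
  flatten [seq w ++ nseq d (beta i) | i <- iota 0 r].
(** With [posB], the state after [i] blocks when the repeated word has [m] insertions of each kind;
    it does not depend on the order inside that word. *)
Definition posA i := i * m + count beta (iota 0 i) * d.
Definition posB i := i * m + count (predC beta) (iota 0 i) * d.

Lemma posAS i : posA i.+1 = posA i + (m + beta i * d).
Proof. by rewrite /posA -addn1 iotaD count_cat /= add0n; lia. Qed.

Lemma posBS i : posB i.+1 = posB i + (m + ~~ beta i * d).
Proof. by rewrite /posB -addn1 iotaD count_cat /= add0n; lia. Qed.

Lemma posAB i : posA i + posB i = i * (2 * m + d).
Proof.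
have := count_predC beta (iota 0 i); rewrite size_iota /posA /posB; nia.
Qed.

Lemma block_pathS r w : block_path r.+1 w = block_path r w ++ (w ++ nseq d (beta r)).
Proof. by rewrite /block_path -addn1 iotaD map_cat flatten_cat /= cats0. Qed.

Lemma count_block_path r w : count id w = m -> count negb w = m ->
  count id (block_path r w) = posA r /\ count negb (block_path r w) = posB r.
Proof.
move=> ca cb; elim: r => [|r [IHa IHb]] //.
by rewrite block_pathS !count_cat IHa IHb posAS posBS ca cb !count_nseq.
Qed.

(** Rebasing at the start of each block turns the rest of the path into a fresh instance, so the
    bound [X], valid for all good layouts, applies in every block. Displacements of older balls over
    the block come on top. *)
Lemma lcost_block_paths (W : seq (seq bool)) (X c : nat) (g : layout) (r : nat) : good g ->
  (forall w, w \in W -> count id w = m /\ count negb w = m) ->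
  (forall g', good g' -> X <= c * \sum_(w <- W) lcost g' 0 0 w) ->
  r * X + c * (size W * \sum_(k < r) moved g (posA k) (posB k) (posA k.+1) (posB k.+1))
  <= c * \sum_(w <- W) lcost g 0 0 (block_path r w).
Proof.
move=> g_good cW hX; elim: r => [|r IH].
  by rewrite big_ord0 !muln0.
have := hX _ (rebase_good g_good (posA r) (posB r)).
set h := moved g (posA r) (posB r) (posA r.+1) (posB r.+1).
set T := \sum_(w <- W) lcost (rebase _ _ _) _ _ _.
(* The induced cost of the [d] extra insertions is dropped, but their effect on the displacement [h]
   is kept. *)
have H : T + size W * h + \sum_(w <- W) lcost g 0 0 (block_path r w)
    <= \sum_(w <- W) lcost g 0 0 (block_path r.+1 w).
  rewrite -sum1_size big_distrl /= -!big_split /= big_seq [leqRHS]big_seq.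
  apply: leq_sum => w wW; have [ca cb] := cW _ wW.
  have [pa pb] := count_block_path r ca cb.
  rewrite block_pathS lcost_cat pa pb !add0n mul1n addnC leq_add2l.
  apply: leq_trans (lcost_rebase (posA r) (posB r) _ g_good).
  rewrite lcost_cat !count_cat ca cb !count_nseq /h posAS posBS; lia.
move=> XT; rewrite big_ord_recr /= -/h; apply: leq_trans (leq_mul (leqnn c) H).
have arith a b e u v : a <= b -> u + v <= e -> (a + u) + (v + c * (size W * h))
    <= b + c * (size W * h) + e by lia.
by rewrite mulSn !mulnDr; apply: arith.
Qed.

End Blocks.

(** * The recursive family of words and its average cost *)

Section Words.
Variables J d : nat.

(** Per kind, [4 * J] copies contribute [4 * J * half_len j] and the extra runs
    [2 * J * unit_len j], which is [2 * half_len j]; hence the ratio [4 * J + 2]. *)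
Definition unit_len j := d * (4 * J + 2) ^ j.
Definition half_len j := J * unit_len j.

(** [orders true] puts the extra a's into the first half of the [4 * J] blocks, [orders false] into
    the second half. *)
Definition orders (b : bool) (i : nat) := (i < 2 * J) == b.

(** One binary choice per level, shared by all copies of that level. The list stands for a uniform
    choice among its entries. *)
Fixpoint words (j : nat) : seq (seq bool) :=
  if j is j'.+1 then
    [seq block_path (unit_len j') (orders true) (4 * J) w | w <- words j']
    ++ [seq block_path (unit_len j') (orders false) (4 * J) w | w <- words j']
  else [:: nseq (half_len 0) true ++ nseq (half_len 0) false].

Lemma size_words j : size (words j) = 2 ^ j.
Proof. by elim: j => //= j IH; rewrite size_cat !size_map IH expnS; lia. Qed.

Lemma count_orders i :
  count (orders true) (iota 0 i) = minn (2 * J) i /\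
  count (orders false) (iota 0 i) = i - 2 * J.
Proof.
have e1 : count (orders true) (iota 0 i) = minn (2 * J) i.
  by rewrite -count_ltn_iota; apply: eq_count => z; rewrite /orders eqb_id.
have := count_predC (orders true) (iota 0 i); rewrite size_iota e1.
have /eq_count -> : predC (orders true) =1 orders false.
  by move=> z; rewrite /orders /=; case: (z < _).
by move=> e2; split=> //; apply: (@addnI (minn (2 * J) i)); rewrite e2; lia.
Qed.

Lemma posA_orders m e i :
  posA m e (orders true) i = i * m + minn (2 * J) i * e /\
  posA m e (orders false) i = i * m + (i - 2 * J) * e.
Proof. by rewrite /posA; have [-> ->] := count_orders i. Qed.

Lemma pos_orders_end m e b :
  posA m e (orders b) (4 * J) = 2 * J * (2 * m + e) /\
  posB m e (orders b) (4 * J) = 2 * J * (2 * m + e).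
Proof.
have a : posA m e (orders b) (4 * J) = 2 * J * (2 * m + e).
  by have [h1 h2] := posA_orders m e (4 * J); case: b; rewrite ?h1 ?h2; nia.
by split=> //; have := posAB m e (orders b) (4 * J); rewrite a; nia.
Qed.

Lemma count_words j w : w \in words j -> count id w = half_len j /\ count negb w = half_len j.
Proof.
elim: j w => [|j IH] w /=.
  by rewrite inE => /eqP ->; rewrite !count_cat !count_nseq /=; lia.
have e : 2 * J * (2 * half_len j + unit_len j) = half_len j.+1.
  by rewrite /half_len /unit_len expnS; nia.
have H v b : v \in words j -> let u := block_path (unit_len j) (orders b) (4 * J) v in
    count id u = half_len j.+1 /\ count negb u = half_len j.+1.
  move=> /IH [ca cb] /=.
  have [-> ->] := count_block_path (unit_len j) (orders b) (4 * J) ca cb.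
  by have [-> ->] := pos_orders_end (half_len j) (unit_len j) b.
by rewrite mem_cat => /orP [] /mapP [v vW ->]; apply: H.
Qed.

(** Consider the a's numbered from [J * (m + e)] up to [2 * J * (m + e)]. Under [orders true] such a
    ball is born in a block [b] with [J <= b < 2 * J], when at least [b * e >= m] extra a's precede
    it; this exceeds one block's share, so under [orders false] it is born in a later block. *)
Lemma sum_moved_orders (g : layout) m e : good g -> m <= J * e ->
  J * m <= 2 *
    (\sum_(k < 4 * J) moved g (posA m e (orders true) k) (posB m e (orders true) k)
       (posA m e (orders true) k.+1) (posB m e (orders true) k.+1)
     + \sum_(k < 4 * J) moved g (posA m e (orders false) k) (posB m e (orders false) k)
       (posA m e (orders false) k.+1) (posB m e (orders false) k.+1)).
Proof.
move=> g_good me.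
have Am b i : posA m e (orders b) i <= posA m e (orders b) i.+1 by rewrite posAS leq_addr.
have Bm b i : posB m e (orders b) i <= posB m e (orders b) i.+1 by rewrite posBS leq_addr.
have [ta tb] := pos_orders_end m e true; have [fa fb] := pos_orders_end m e false.
have := sum_moved_ge (r := 4 * J) g_good (Am true) (Bm true) (Am false) (Bm false)
  (posAB m e _) (posAB m e _).
rewrite ta tb fa fb => /(_ erefl erefl); apply: leq_trans.
have pr b x : x \in ball_seq (2 * J * (2 * m + e)) (2 * J * (2 * m + e)) ->
    present (posA m e (orders b) (4 * J)) (posB m e (orders b) (4 * J)) x.
  by have [-> ->] := pos_orders_end m e b; rewrite mem_ball_seq.
apply: (@leq_trans (size (map (@inl nat nat) (iota (J * (m + e)) (J * (m + e)))))).
  by rewrite size_map size_iota; nia.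
rewrite -size_filter; apply: uniq_leq_size.
  by rewrite map_inj_uniq ?iota_uniq //; exact: inl_inj.
move=> x /mapP [i]; rewrite mem_iota => hi ->.
have xin : inl i \in ball_seq (2 * J * (2 * m + e)) (2 * J * (2 * m + e)).
  by rewrite mem_ball_seq /=; nia.
rewrite mem_filter xin andbT; apply/eqP => eb.
have := birthP (posAB m e (orders true)) (pr true _ xin).
have := birthP (posAB m e (orders false)) (pr false _ xin).
rewrite eb; set b := birth _ _ _ _.
have [-> _] := posA_orders m e b; have [-> _] := posA_orders m e b.+1.
have [_ ->] := posA_orders m e b; have [_ ->] := posA_orders m e b.+1.
rewrite /present -!leqNgt; nia.
Qed.

(** The [4 * J] copies carry over the bound of the previous level, and the conflict between the two
    orders adds one more term of the same size. Bounding [half_len j] below by a power of [4 * J]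
    makes these terms equal across levels. *)
Lemma words_cost j (g : layout) : good g ->
  2 ^ j * (j * (4 * J) ^ j * (J * d)) <= 16 * \sum_(w <- words j) lcost g 0 0 w.
Proof.
elim: j g => [|j IH] g g_good; first by rewrite !mul0n muln0.
have H b := lcost_block_paths (unit_len j) (orders b) (4 * J) g_good (@count_words j) IH.
rewrite /= big_cat !big_map /=.
have len_ge : J * d * (4 * J) ^ j <= half_len j.
  have pow_le : (4 * J) ^ j <= (4 * J + 2) ^ j by case: (j) => // k; rewrite leq_exp2r // leq_addr.
  by rewrite /half_len /unit_len -mulnA !leq_mul.
have := leq_trans (leq_mul (leqnn J) len_ge) (sum_moved_orders g_good (leqnn (half_len j))).
have := H true; have := H false.
rewrite size_words !expnS.
move: (2 ^ j) ((4 * J) ^ j) (\sum_(w <- _) _) (\sum_(w <- _) _) (\sum_(k < _) _) (\sum_(k < _) _).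
move=> a b L2 L1 s2 s1 hL2 hL1 /(leq_mul (leqnn a)) hs.
(* The added term is 8 times the displacement bound, which itself carries a factor 2; this fixes the
   constant 16. *)
have -> : 2 * a * (j.+1 * (4 * J * b) * (J * d))
    = 2 * (4 * J * (a * (j * b * (J * d)))) + 8 * (a * (J * (J * d * b))) by nia.
by move: hL1 hL2 hs; rewrite !mulnDr; lia.
Qed.

End Words.

(** * Choice of the number of levels *)

Section Levels.
Local Open Scope R_scope.

(** Squaring [1 + y / 2 <= exp (y / 2)] gives a quadratic that dominates [4 * y] from 12 on. *)
Lemma four_le_exp (y : R) : 12 <= y -> 4 * y <= exp y.
Proof.
move=> y12; have h := exp_ineq1_le (y / 2).
have -> : exp y = exp (y / 2) * exp (y / 2) by rewrite -exp_plus; f_equal; lra.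
have : (1 + y / 2) * (1 + y / 2) <= exp (y / 2) * exp (y / 2) by apply: Rmult_le_compat; lra.
nra.
Qed.

Lemma ln_mono (x y : R) : 0 < x -> x <= y -> ln x <= ln y.
Proof. by move=> x0 [/(ln_increasing _ _ x0)|->]; lra. Qed.

Lemma exists_floor (x : R) : 1 <= x -> exists J : nat, [/\ 1 <= INR J, INR J <= x & x <= 2 * INR J].
Proof.
move=> x1; have [u1 u2] := archimed x.
have uz : Z.lt 1 (up x) by apply: lt_IZR; lra.
have [k ek] : exists k : nat, Z.sub (up x) 1 = Z.of_nat k by apply: IZN; lia.
have e : INR k = IZR (up x) - 1 by rewrite INR_IZR_INZ -ek minus_IZR.
have k1 : 1 <= INR k by rewrite INR_IZR_INZ -ek; apply: IZR_le; lia.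
by exists k; rewrite e in k1 *; split; lra.
Qed.

(** With [L = ln n] and [y = ln L], take [J] as the floor of [L / (4 * y)]. Then
    [J * (4 * J + 2) ^ J] is at most [L ^ (J + 1) = exp (y * (J + 1))], and [y * (J + 1) <= L]
    because [y * J] and [y] are both at most [L / 4]. *)
Lemma choose_levels : exists N : nat, forall n : nat, INR N <= INR n ->
  exists J : nat, [/\ 1 <= INR J, INR J * (4 * INR J + 2) ^ J <= INR n,
    ln (INR n) <= 8 * INR J * ln (ln (INR n)) & 0 < ln (ln (INR n))].
Proof.
have [N [_ _ hN]] : exists N : nat,
    [/\ 1 <= INR N, INR N <= exp (exp 12) & exp (exp 12) <= 2 * INR N].
  by apply: exists_floor; have := exp_ineq1_le (exp 12); have := exp_pos 12; lra.
(* This threshold is at least [exp (exp 12)], so [ln (ln n) >= 12]. *)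
exists (2 * N)%coq_nat => n; rewrite mult_INR /= => hn.
set L := ln (INR n); set y := ln L.
have n_pos : 0 < INR n by have := exp_pos (exp 12); lra.
have L_ge : exp 12 <= L.
  rewrite -(ln_exp (exp 12)); apply: ln_mono; [exact: exp_pos | lra].
have L_pos : 0 < L by have := exp_pos 12; lra.
have y_ge : 12 <= y.
  by rewrite -(ln_exp 12); apply: ln_mono => //; exact: exp_pos.
have L_y : exp y = L by rewrite exp_ln.
have L4 : 4 * y <= L by rewrite -L_y; apply: four_le_exp.
have [J [J1 Jle Jge]] : exists J : nat,
    [/\ 1 <= INR J, INR J <= L / (4 * y) & L / (4 * y) <= 2 * INR J].
  apply: exists_floor; apply: (Rmult_le_reg_r (4 * y)); first lra.
  by have -> : L / (4 * y) * (4 * y) = L by [field; lra]; lra.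
have Jle' : 4 * y * INR J <= L.
  have -> : L = L / (4 * y) * (4 * y) by field; lra.
  by rewrite Rmult_comm; apply: Rmult_le_compat_r; lra.
have Jge' : L <= 8 * INR J * y.
  have -> : L = L / (4 * y) * (4 * y) by field; lra.
  by have := Rmult_le_compat_r (4 * y) _ _ _ Jge; lra.
exists J; split=> //; last lra.
have base : 4 * INR J + 2 <= L by nra.
have hpow : (4 * INR J + 2) ^ J <= L ^ J by apply: pow_incr; lra.
have pow_pos : 0 <= (4 * INR J + 2) ^ J by apply: pow_le; lra.
have -> : INR n = exp L by rewrite exp_ln.
apply: (Rle_trans _ (L ^ J.+1)).
  by rewrite /=; apply: Rmult_le_compat; lra.
have -> : L ^ J.+1 = exp (y * INR J.+1).
  by rewrite -(Rpower_pow _ _ L_pos) /Rpower -/y Rmult_comm.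
have : y * INR J.+1 <= L by rewrite S_INR; nra.
by case=> [/exp_increasing|->]; lra.
Qed.

End Levels.

(** * Placements viewed as layouts, with bin 0 as a dummy for absent balls *)

Definition layout_of (f : placement) : layout := fun p q x =>
  match x with
  | inl i => oapp (fun k : 'I_p => nat_of_ord (f p q (inl k))) 0 (insub i)
  | inr j => oapp (fun k : 'I_q => nat_of_ord (f p q (inr k))) 0 (insub j)
  end.

Definition ball_of p q (x : balls p q) : ball :=
  match x with inl i => inl (val i) | inr j => inr (val j) end.

Lemma layout_of_ball f p q (x : balls p q) : layout_of f p q (ball_of x) = f p q x.
Proof. by case: x => i; rewrite /= valK. Qed.

Lemma ball_ofP p q x : x \in ball_seq p q -> exists y : balls p q, x = ball_of y.
Proof.
rewrite mem_ball_seq; case: x => i lt; first by exists (inl (Ordinal lt)).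
by exists (inr (Ordinal lt)).
Qed.

Lemma layout_of_good f : bij_family f -> good (layout_of f).
Proof.
move=> f_bij p q; split=> [x y|x] /ball_ofP [x' ->].
  move=> /ball_ofP [y' ->]; rewrite !layout_of_ball => /val_inj.
  by move=> /(bij_inj (f_bij p q)) ->.
by rewrite layout_of_ball.
Qed.

(** Stated for an abstract embedding to cover both [lift_a] and [lift_b]. *)
Lemma moved_le_card f p q p' q' (emb : balls p q -> balls p' q') :
  (forall x, ball_of (emb x) = ball_of x) ->
  moved (layout_of f) p q p' q'
  <= #|[pred x : balls p q | nat_of_ord (f p' q' (emb x)) != nat_of_ord (f p q x)]|.
Proof.
move=> embE; rewrite /moved -size_filter cardE -(size_map (@ball_of p q)).
apply: uniq_leq_size; first exact/filter_uniq/ball_seq_uniq.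
move=> x; rewrite mem_filter => /andP [ne /ball_ofP [y ey]]; subst x.
apply: map_f; rewrite mem_enum inE.
by rewrite -!layout_of_ball embE.
Qed.

Lemma lcost_le_cost f p q s : lcost (layout_of f) p q s <= cost_from f p q s.
Proof.
elim: s p q => //= b s IH p q; case: b; apply: leq_add (IH _ _).
  by apply: (@moved_le_card f p q p.+1 q (@lift_a p q)) => -[].
by apply: (@moved_le_card f p q p q.+1 (@lift_b p q)) => -[].
Qed.

(** * The distribution and the final estimate *)

Section Uniform.
Local Open Scope ring_scope.

(** Weighting tuples by multiplicity accounts for possible repetitions in [W]. *)
Lemma sum_count_mem (n : nat) (W : seq (seq bool)) (F : seq bool -> R) :
  {in W, forall w, size w = n} ->
  \sum_(t : n.-tuple bool) (count_mem (val t) W)%:R * F (val t) = \sum_(w <- W) F w.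
Proof.
elim: W => [|w W IH] sW.
  by rewrite big_nil big1 // => t _; rewrite mul0r.
rewrite big_cons -IH; last by move=> v vW; rewrite sW // inE vW orbT.
have /eqP w_n := sW w (mem_head _ _).
under eq_bigr => t _ do rewrite /= natrD mulrDl.
rewrite big_split /= (bigD1 (Tuple w_n)) //= eqxx mul1r big1 ?addr0 // => t ne.
case: eqP => [e|_]; last by rewrite mul0r.
by case/eqP: ne; apply: val_inj.
Qed.

End Uniform.

(** The suffix brings both counts to exactly [n] once [e] is the missing amount. *)
Definition padded (J d e : nat) : seq (seq bool) :=
  [seq w ++ (nseq e true ++ nseq e false) | w <- words J d J].

Lemma count_padded J d e w : w \in padded J d e ->
  count id w = half_len J d J + e /\ count negb w = half_len J d J + e.
Proof.
move=> /mapP [v /count_words [ca cb] ->].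
by rewrite !count_cat ca cb !count_nseq /= !mul1n !mul0n addn0 add0n.
Qed.

(** This amounts to [(1 + 1 / (2 * J)) ^ J <= 2], proved through a Bernoulli-type inequality for all
    exponents up to [J]. *)
Lemma half_len_le J d : half_len J d J <= 2 * ((4 * J) ^ J * (J * d)).
Proof.
have H i : i <= J -> (4 * J + 2) ^ i * (4 * J - 2 * i) <= (4 * J) ^ i * (4 * J).
  elim: i => [|i IH] iJ; first by rewrite muln0 subn0.
  rewrite (expnS (4 * J)) -(mulnA (4 * J)).
  apply: leq_trans (leq_mul (leqnn (4 * J)) (IH (ltnW iJ))).
  rewrite expnS (mulnC (4 * J + 2)) -mulnA (mulnCA (4 * J)) leq_mul2l; apply/orP; right; nia.
have := H J (leqnn J); rewrite /half_len /unit_len.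
move: ((4 * J + 2) ^ J) ((4 * J) ^ J) => a b h.
case: (posnP J) h => [->|J0] h; first by rewrite !mul0n.
have {}h : a <= 2 * b by have : 2 * J * a <= 2 * J * (2 * b) by [nia]; rewrite leq_pmul2l //; lia.
by have := leq_mul (leqnn (J * d)) h; lia.
Qed.

Lemma half_len_bounds J n : 0 < J -> J * (4 * J + 2) ^ J <= n ->
  half_len J (n %/ (J * (4 * J + 2) ^ J)) J <= n
  <= 2 * half_len J (n %/ (J * (4 * J + 2) ^ J)) J.
Proof.
move=> J0; have X0 : 0 < J * (4 * J + 2) ^ J by rewrite muln_gt0 J0 expn_gt0 addn2.
rewrite /half_len /unit_len mulnCA; move: (J * _) X0 => X X0 Xn.
have d0 : 0 < n %/ X by rewrite divn_gt0.
rewrite leq_trunc_div /= [leqLHS](divn_eq n X); have := ltn_pmod n X0; nia.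
Qed.

(** The cost of the padding is dropped. The constant 64 is the 16 of [words_cost] times 2 for
    rounding [n] and 2 for [half_len_le]. *)
Lemma padded_cost f J d e n : bij_family f -> n <= 2 * half_len J d J ->
  2 ^ J * (J * n) <= 64 * \sum_(w <- padded J d e) cost_from f 0 0 w.
Proof.
move=> f_bij n_le; have := words_cost J d J (layout_of_good f_bij).
have : \sum_(w <- words J d J) lcost (layout_of f) 0 0 w
    <= \sum_(w <- padded J d e) cost_from f 0 0 w.
  rewrite big_map; apply: leq_sum => w _.
  by apply: leq_trans (lcost_le_cost f 0 0 _); rewrite lcost_cat leq_addr.
have := leq_mul (leqnn (2 ^ J * J)) (leq_trans n_le (leq_mul (leqnn 2) (half_len_le J d))).
move: (\sum_(w <- _) _) (\sum_(w <- _) _) (2 ^ J) ((4 * J) ^ J) => a b c e'; nia.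
Qed.

Theorem theorem6p1 :
  exists c : R, (0 < c)%R /\
  exists N : nat, forall n : nat, (N <= n)%N ->
    exists mu : {ffun (n.*2).-tuple bool -> R},
      instance_distr mu /\
      forall f : placement, bij_family f ->
        (c * n%:R * ln n%:R / ln (ln n%:R) <= expected_cost mu f)%R.
Proof.
have [N hN] := choose_levels.
(* Here 512 is 64 from [padded_cost] times 8 from the choice of [J]. *)
exists (512%:R^-1)%R; split; first by rewrite invr_gt0 ltr0n.
exists N => n Nn.
have [|J [J1 Jn ln_le lnln_gt0]] := hN n; first exact/le_INR/leP.
have J0 : 0 < J by apply/ltP/INR_lt; apply: Rlt_le_trans J1; exact: Rlt_0_1.
have {}Jn : J * (4 * J + 2) ^ J <= n.
  apply/leP/INR_le; move: Jn; rewrite !INRE RpowE natrM natrX natrD natrM.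
  by have -> : IZR 4 = (4%:R)%R :> R by rewrite -INRE /=; lra.
pose d := n %/ (J * (4 * J + 2) ^ J).
have /andP [len_le n_le] := half_len_bounds J0 Jn; rewrite -/d in len_le n_le.
pose W := padded J d (n - half_len J d J).
have W_count w : w \in W -> count id w = n /\ count negb w = n.
  by move=> /count_padded; rewrite subnKC.
have W_size : {in W, forall w, size w = n.*2}.
  by move=> w /W_count [ca cb]; rewrite -(count_predC id w) ca -addnn; congr (_ + _).
have size_W : size W = 2 ^ J by rewrite size_map size_words.
(* The empirical measure of the list [W]. *)
exists [ffun t => ((count_mem (val t) W)%:R / (2 ^ J)%:R)%R].
have pow0 : (0 < (2 ^ J)%:R :> R)%R by rewrite ltr0n expn_gt0.
split; first split.
- by move=> t; rewrite ffunE divr_ge0 ?ler0n.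
- under eq_bigr => t _ do rewrite ffunE -[X in (X / _)%R]mulr1.
  rewrite -mulr_suml (@sum_count_mem _ W (fun _ => 1%R)) //.
  rewrite big_const_seq count_predT iter_addr_0 size_W divff //.
  by rewrite lt0r_neq0.
- move=> t; rewrite ffunE; case: (boolP (val t \in W)) => [/W_count [] //|/count_memPn ->].
  by rewrite mul0r eqxx.
move=> f f_bij; rewrite /expected_cost.
under eq_bigr => t _ do rewrite ffunE mulrAC.
rewrite -mulr_suml (@sum_count_mem _ W (fun w => (cost_from f 0 0 w)%:R)%R) //.
rewrite -natr_sum ler_pdivlMr //.
have := padded_cost (n - half_len J d J) f_bij n_le; rewrite -/W.
rewrite -(ler_nat R) !natrM; move: ((2 ^ J)%:R)%R pow0 => A A0 cost_ge.
have ln_ratio : (ln n%:R / ln (ln n%:R) <= 8%:R * J%:R :> R)%R.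
  move: ln_le lnln_gt0; rewrite !INRE => ln_le /RltP lnln_gt0.
  rewrite ler_pdivrMr //; apply/RleP; move: ln_le.
  by have -> : IZR 8 = (8%:R)%R :> R by rewrite -INRE /=; lra.
apply: (@Order.POrderTheory.le_trans _ _ (512%:R^-1 * n%:R * (8%:R * J%:R) * A)%R).
  rewrite -[X in (X * A)%R]mulrA ler_pM2r // ler_wpM2l //.
  by rewrite mulr_ge0 ?invr_ge0 ?ler0n.
rewrite -(@ler_pM2l _ 64%:R%R) ?ltr0n //; apply: Order.POrderTheory.le_trans cost_ge.
have -> : (512%:R = 64%:R * 8%:R :> R)%R by rewrite -natrM.
rewrite invfM; set u := (64%:R)%R; set v := (8%:R)%R.
have u0 : u != 0%R by rewrite lt0r_neq0 ?ltr0n.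
have v0 : v != 0%R by rewrite lt0r_neq0 ?ltr0n.
rewrite -!mulrA mulVKf // [in X in (X <= _)%R]mulrCA mulKf //.
by rewrite mulrCA [in X in (_ <= X)%R]mulrCA (mulrC A).
Qed.
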